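(* Let $H$ be a self-adjoint operator on a $2^L$-dimensional Hilbert space whose eigenvalues, counted with multiplicity, are $E_{\boldsymbol n}=E_0+\sum_{k=1}^Ln_k\Lambda_k$, $\boldsymbol n\in\{0,1\}^L$, with real $E_0,\Lambda_1,\dots,\Lambda_L$. Let $\epsilon_1,\dots,\epsilon_{L_B}$ be the distinct values among the $\Lambda_k$, $\epsilon_j$ occurring $g_j$ times, and assume $\epsilon_1,\dots,\epsilon_{L_B}$ are linearly independent over $\mathbb Q$. Let $\chi(t)=\operatorname{tr}(e^{-itH})$. Then for every $M\in\mathbb N$, $$\overline{|\chi(t)|^{2M}}=\prod_{j=1}^{L_B}\binom{2g_jM}{g_jM}.$$
   Context: $\overline{f(t)}:=\lim_{T\to\infty}\frac1T\int_0^Tf(t)\,dt$. *)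

(* Defs.v *)
From HB Require Import structures.
From mathcomp Require Import all_boot all_order all_algebra.
From mathcomp Require Import all_classical all_reals all_analysis.
From mathcomp.real_closed Require Import complex.
Set Implicit Arguments. Unset Strict Implicit. Unset Printing Implicit Defensive.
Import Order.TTheory GRing.Theory Num.Theory.
Import numFieldNormedType.Exports.
Local Open Scope ring_scope.
Local Open Scope complex_scope.
Local Open Scope classical_set_scope.

(* Matrix exponential of a complex square matrix, via its power series
   exp(A) = lim_{N -> oo} sum_{k < N} A^k / k!  (the series always converges). *)
Definition expm (R : realType) (n : nat) (A : 'M[R[i]]_n) : 'M[R[i]]_n :=
  lim ((fun N : nat => \sum_(k < N) ((k`!)%:R^-1 *: A ^+ k)) @ \oo).

Definition self_adjoint (R : realType) (n : nat) (H : 'M[R[i]]_n) : Prop :=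
  (map_mx Num.conj H)^T = H.

Definition chi (R : realType) (n : nat) (H : 'M[R[i]]_n) (t : R) : R[i] :=
  \tr (expm ((- ('i * t%:C)) *: H)).

Definition cmod (R : realType) (z : R[i]) : R := complex.Re `|z|.

Definition energy (R : realType) (L : nat) (E0 : R) (Lam : 'I_L -> R)
  (n : {ffun 'I_L -> bool}) : R :=
  E0 + \sum_(k < L) (n k)%:R * Lam k.

Definition distinct_vals (R : realType) (L : nat) (Lam : 'I_L -> R) : seq R :=
  undup [seq Lam k | k <- enum 'I_L].

Definition mult (R : realType) (L : nat) (Lam : 'I_L -> R) (e : R) : nat :=
  #|[set k : 'I_L | Lam k == e]|.

Definition Q_lin_indep (R : realType) (s : seq R) : Prop :=
  forall q : 'I_(size s) -> rat,
    \sum_(j < size s) ratr (q j) * nth 0 s j = 0 -> forall j, q j = 0.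

Definition time_average_is (R : realType) (f : R -> R) (l : R) : Prop :=
  (fun T : R => T^-1 * Rintegral (@lebesgue_measure R) `[0, T] f) @ +oo --> l.

(* Main.v *)
(** In an orthonormal eigenbasis, [chi t] is the sum of the phases [cis (- t E)]
    over the spectrum, and the free-fermion form of the spectrum makes it, up to
    a global phase, the product of the factors [1 + cis (- t Lam_k)].  Grouping
    equal [Lam_k], [|chi t|^(2M)] is the product over the distinct values [e] of
    [((1 + cis (- t e)) (1 + cis (t e)))^N] with [N = g_e M], which is
    [cis (- N t e) (1 + cis (t e))^(2N)].  The binomial theorem turns the whole
    product into a finite trigonometric sum, whose time average is the total
    coefficient of the zero frequency.  By rational independence that frequency
    arises only from the middle term of every binomial expansion. *)
Require Import Defs.
From HB Require Import structures.
From mathcomp Require Import all_boot all_order all_algebra.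
From mathcomp Require Import all_classical all_reals all_analysis.
From mathcomp Require Import ring.
From mathcomp.real_closed Require Import complex.
Import Order.TTheory GRing.Theory Num.Theory.
Import numFieldNormedType.Exports.
Local Open Scope ring_scope.
Local Open Scope complex_scope.
Local Open Scope classical_set_scope.

(** * Unit phases *)

Definition cis {R : realType} (x : R) : R[i] := cos x +i* sin x.

Lemma cis0 {R : realType} : cis (0 : R) = 1.
Proof. by rewrite /cis cos0 sin0. Qed.

Lemma cisD {R : realType} (x y : R) : cis (x + y) = cis x * cis y.
Proof.
rewrite /cis cosD sinD; apply/eqP.
by rewrite eq_complex /= addrC eqxx /= addrC eqxx.
Qed.

Lemma cisMn {R : realType} (x : R) n : cis (x *+ n) = cis x ^+ n.
Proof.
by elim: n => [|n IH]; rewrite ?mulr0n ?cis0 // mulrS exprS cisD IH.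
Qed.

Lemma cis_sum {R : realType} I (r : seq I) (F : I -> R) :
  cis (\sum_(i <- r) F i) = \prod_(i <- r) cis (F i).
Proof. exact: (big_morph _ (@cisD R) (@cis0 R)). Qed.

Lemma conj_cis {R : realType} (x : R) : (cis x)^*%C = cis (- x).
Proof. by rewrite /cis cosN sinN. Qed.

(** * Exponential series of scalars and of diagonalizable matrices *)

Lemma cvg_complex {R : realType} (u v : nat -> R) (a b : R) :
  u @ \oo --> a -> v @ \oo --> b ->
  (fun n => u n +i* v n) @ \oo --> (a +i* b : (R[i] : numFieldType)).
Proof.
move=> /cvgrPdist_lt ua /cvgrPdist_lt vb.
apply/(@cvgrPdist_lt _ (R[i] : numFieldType)) => -[e e'] /=.
(* A positive element of [R[i]] has zero imaginary part, so the tolerance is a real [e], to be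
   halved between the two components. *)
rewrite ltcE /= => /andP[/eqP-> e0].
near=> n.
have -> : (a +i* b) - (u n +i* v n) = (a - u n)%:C + 'i * (b - v n)%:C.
  by apply/eqP; rewrite eq_complex /= !(mul0r, mulr0, addr0, add0r, subr0, mul1r) !eqxx.
apply: (le_lt_trans (ler_normD _ _)).
rewrite normrM !normc_def /= !expr0n /= !addr0 add0r expr1n sqrtr1 mul1r.
rewrite !sqrtr_sqr -raddfD /= ltcR.
rewrite [X in _ < X]splitr ltrD //; near: n; [apply: ua|apply: vb]; exact: divr_gt0.
Unshelve. all: by end_near. Qed.

Lemma exp_series_term {R : realType} (x : R) k :
  (k`!)%:R^-1 * ('i * x%:C) ^+ k = cos_coeff x k +i* sin_coeff x k.
Proof.
have -> : 'i * x%:C = 0 +i* x.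
  by apply/eqP; rewrite eq_complex /= !(mul0r, mulr0, mul1r, subr0, add0r, oppr0) !eqxx.
(* At [k = 0] the truncated [k.-1] is harmless, since the factor [odd k] vanishes there. *)
have -> : (0 +i* x) ^+ k = ((~~ odd k)%:R * (-1) ^+ k./2 * x ^+ k) +i*
                          ((odd k)%:R * (-1) ^+ k.-1./2 * x ^+ k).
  elim: k => [|k IH]; first by rewrite !expr0 /= mul0r !mulr1.
  rewrite exprS IH; apply/eqP; rewrite eq_complex /=; apply/andP; split; apply/eqP.
    case: k {IH} => [|k]; rewrite /= ?negbK; first by rewrite !(mul0r, mulr0, subr0).
    by rewrite !exprS; ring.
  by rewrite !exprS; ring.
apply/eqP; rewrite eq_complex cos_coeffE sin_coeffE.
have -> : (k`!)%:R^-1 = ((k`!)%:R^-1 : R)%:C by rewrite fmorphV rmorph_nat.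
by rewrite /= !(mul0r, subr0, addr0); apply/andP; split; apply/eqP; ring.
Qed.

Lemma cvg_cis {R : realType} (x : R) :
  (fun N => \sum_(k < N) (k`!)%:R^-1 * ('i * x%:C) ^+ k) @ \oo -->
    (cis x : (R[i] : numFieldType)).
Proof.
under eq_fun do under eq_bigr do rewrite exp_series_term.
rewrite (_ : (fun N => _) =
  (fun N => series (cos_coeff x) N +i* series (sin_coeff x) N)); last first.
  apply/funext => N; rewrite /series /= !big_mkord.
  by apply/eqP; rewrite eq_complex !raddf_sum !eqxx.
by apply: cvg_complex; rewrite ?cos.unlock ?sin.unlock;
  [exact: is_cvg_series_cos_coeff|exact: is_cvg_series_sin_coeff].
Qed.

Lemma expr_conj_diag (F : fieldType) n (P : 'M[F]_n) (d : 'rV[F]_n) k :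
  P \in unitmx ->
  (invmx P *m diag_mx d *m P) ^+ k =
  invmx P *m diag_mx (\row_i d 0 i ^+ k) *m P.
Proof.
move=> Pu; elim: k => [|k IH].
  rewrite expr0 (_ : diag_mx _ = 1%:M) ?mulmx1 ?mulVmx //.
  by apply/matrixP => i j; rewrite !mxE expr0.
rewrite exprS IH -mulmxE !mulmxA mulmxK //; congr (_ *m _).
rewrite -!mulmxA; congr (_ *m _); apply/matrixP=> i j.
by rewrite mul_diag_mx !mxE exprS mulrnAr.
Qed.

(** Every partial sum is a scalar combination of the fixed matrices [invmx P *m delta_mx i i *m P],
    so the matrix limit reduces to the scalar limits of the coefficients. *)
Lemma expm_conj_diag {R : realType} n (P : 'M[R[i]]_n) (d l : 'rV[R[i]]_n) :
  P \in unitmx ->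
  (forall i, (fun N => \sum_(k < N) (k`!)%:R^-1 * d 0 i ^+ k) @ \oo -->
    (l 0 i : (R[i] : numFieldType))) ->
  expm (invmx P *m diag_mx d *m P) = invmx P *m diag_mx l *m P.
Proof.
move=> Pu dl.
apply: (@cvg_lim ('M[(R[i] : numFieldType)]_n : normedModType (R[i] : numFieldType))).
  exact: norm_hausdorff.
have E (w : 'rV[R[i]]_n) : invmx P *m diag_mx w *m P =
    \sum_i w 0 i *: (invmx P *m delta_mx i i *m P).
  rewrite diag_mx_sum_delta mulmx_sumr mulmx_suml; apply: eq_bigr => i _.
  by rewrite -scalemxAr -scalemxAl.
rewrite (E l).
rewrite (_ : (fun N => _) = (fun N => \sum_i (\sum_(k < N) (k`!)%:R^-1 * d 0 i ^+ k) *: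
   (invmx P *m delta_mx i i *m P))); last first.
  apply/funext => N; under [RHS]eq_bigr do rewrite scaler_suml.
  rewrite exchange_big /=; apply: eq_bigr => k _.
  rewrite expr_conj_diag // E scaler_sumr; apply: eq_bigr => i _.
  by rewrite mxE scalerA.
apply: cvg_big => [|i _]; first exact: add_continuous.
exact: cvgZr_tmp.
Qed.

Lemma char_poly_conj_diag (F : fieldType) n (P : 'M[F]_n) (d : 'rV[F]_n) :
  P \in unitmx ->
  char_poly (invmx P *m diag_mx d *m P) = \prod_i ('X - (d 0 i)%:P).
Proof.
move=> Pu; transitivity (char_poly (diag_mx d)); last first.
  rewrite char_poly_trig ?diag_mx_is_trig //.
  by apply: eq_bigr => i _; rewrite mxE eqxx mulr1n.
rewrite /char_poly /char_poly_mx !map_mxM.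
have VP : map_mx polyC (invmx P) *m map_mx polyC P = 1%:M.
  by rewrite -map_mxM mulVmx // map_mx1.
(* The scalar matrix is its own conjugate; written so, the whole difference becomes one conjugation
   and the determinants of [P] and its inverse cancel. *)
rewrite {1}(_ : 'X%:M = map_mx polyC (invmx P) *m 'X%:M *m map_mx polyC P); last first.
  by rewrite mul_mx_scalar -scalemxAl VP scalemx1.
by rewrite -mulmxBl -mulmxBr !det_mulmx mulrAC -det_mulmx VP det1 mul1r.
Qed.

(** * Time averages of trigonometric sums *)

(** Division by zero gives 0, so frequency zero needs its own primitive; its linear growth is what
    survives averaging. *)
Lemma is_derive_cos_primitive {R : realType} (a t : R) :
  is_derive t 1 (fun t => if a == 0 then t else sin (t * a) / a) (cos (t * a)).
Proof.
case: eqVneq => [->|a0]; first by rewrite mulr0 cos0; exact: is_derive_id.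
apply: is_derive_eq.
by rewrite !scaler0 !add0r /GRing.scale /= mulr1 mulrC mulfK.
Qed.

(** The integral is a primitive [F] vanishing at 0. Divided by [T], a zero-frequency term is
    constant and any other term is bounded over [T]. *)
Lemma time_average_trig_sum {R : realType} (I : finType) (c w : I -> R) :
  time_average_is (fun t => \sum_i c i * cos (t * w i)) (\sum_(i | w i == 0) c i).
Proof.
pose G (a t : R) := if a == 0 then t else sin (t * a) / a.
pose F := \sum_i (c i *: G (w i)).
have dF (t : R) : is_derive t 1 F (\sum_i c i * cos (t * w i)).
  apply: (big_ind2 (fun f (d : R) => is_derive t 1 f d)) => [|f ? g ?|i _].
  - exact: is_derive_cst.
  - exact: is_deriveD.
  - apply: is_deriveZ; exact: is_derive_cos_primitive.
have F0 : F 0 = 0.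
  rewrite /F fct_sumE big1 // => i _.
  have E : G (w i) 0 = 0 by rewrite /G mul0r sin0 mul0r if_same.
  by transitivity (c i * G (w i) 0); [|rewrite E mulr0].
have cf : continuous (fun t : R => \sum_i c i * cos (t * w i)).
  move=> t; apply: cvg_big => [|i _]; first exact: add_continuous.
  apply: cvgM; first exact: cvg_cst.
  apply: continuous_comp; last exact: continuous_cos.
  by apply: cvgM; [exact: cvg_id|exact: cvg_cst].
have cF : continuous F.
  by move=> t; apply: differentiable_continuous; apply/derivable1_diffP; case: (dF t).
have iF (T : R) : 0 < T ->
    T^-1 * Rintegral (@lebesgue_measure R) `[0, T]
      (fun t => \sum_i c i * cos (t * w i)) = T^-1 * F T.
  move=> T0; congr (_ * _).
  rewrite /Rintegral (@continuous_FTC2 _ _ F) //=.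
  - by rewrite F0 subr0.
  - exact: continuous_subspaceT.
  - split => [t _||]; first by case: (dF t).
    + exact/cvg_at_right_filter/cF.
    + exact/cvg_at_left_filter/cF.
  - by move=> t _; rewrite derive1E; case: (dF t).
rewrite /time_average_is.
apply: (@cvg_trans _ ((fun T => T^-1 * F T) @ +oo)).
  apply: near_eq_cvg; near=> T; rewrite iF //; near: T; exact: nbhs_pinfty_gt.
under eq_fun do rewrite /F fct_sumE mulr_sumr.
rewrite big_mkcond.
suff cG i : x^-1 * (c i *: G (w i)) x @[x --> +oo] --> (if w i == 0 then c i else 0).
  exact: (@cvg_big R I +%R 0 xpredT add_continuous R (pinfty_nbhs R) _
    (fun i x => x^-1 * (c i *: G (w i)) x) _ _ (fun i _ => cG i)).
rewrite (_ : (fun x => _) = (fun x => x^-1 * (c i * G (w i) x))) // /G.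
case: eqVneq => wi.
  apply: (@cvg_trans _ ((fun T : R => c i) @ +oo)); last exact: cvg_cst.
  apply: near_eq_cvg; near=> T; rewrite mulrC -mulrA divff ?mulr1 //.
  by apply: lt0r_neq0; near: T; exact: nbhs_pinfty_gt.
apply/cvgr0Pnorm_lt => e e0; near=> T.
have T0 : 0 < T by near: T; exact: nbhs_pinfty_gt.
rewrite !normrM !normfV (gtr0_norm T0) ltr_pdivrMl //.
(* As the sine is at most 1 in modulus, this bound is uniform in [T], and it suffices that [T]
   exceed it divided by [e]. *)
apply: (@le_lt_trans _ _ (`|c i| / `|w i|)).
  by rewrite ler_wpM2l // ler_piMl // ?invr_ge0 // sin_max.
rewrite -ltr_pdivrMr //; near: T; apply: nbhs_pinfty_gt; exact: num_real.
Unshelve. all: by end_near. Qed.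

(** * The trace as a sum over the spectrum *)

(** The spectral theorem diagonalizes [H]; unique factorization of its characteristic polynomial
    matches the diagonal with the values [E n] up to order. *)
Lemma chi_sum_cis {R : realType} m (I : finType) (H : 'M[R[i]]_m) (E : I -> R)
  (t : R) :
  self_adjoint H ->
  char_poly H = \prod_(n : I) ('X - ((E n)%:C)%:P) ->
  chi H t = \sum_n cis (- (t * E n)).
Proof.
rewrite /self_adjoint => Hsa Hchar.
have Hn : H \is normalmx.
  apply: hermitian_normalmx; rewrite is_hermitianmxE expr0 scale1r.
  by rewrite -map_trmx Hsa.
set P := spectralmx H; set d := spectral_diag H.
have HE : H = invmx P *m diag_mx d *m P by exact: (orthomx_spectralP Hn).
have Pu : P \in unitmx by exact: spectral_unit.
have dE : perm_eq [seq d 0 i | i <- index_enum 'I_m] [seq (E n)%:C | n <- index_enum I].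
  by apply: prod_XsubC_eq; rewrite !big_map -Hchar HE char_poly_conj_diag.
(* The diagonal entries are real because each is one of the [E n]. *)
pose e i := complex.Re (d 0 i).
have de i : d 0 i = (e i)%:C.
  have : d 0 i \in [seq (E n)%:C | n <- index_enum I].
    by rewrite -(perm_mem dE); apply: map_f; rewrite mem_index_enum.
  by case/mapP => n _; rewrite /e => ->.
rewrite /chi HE scalemxAl scalemxAr.
have -> : (- ('i * t%:C)) *: diag_mx d = diag_mx ((- ('i * t%:C)) *: d).
  by apply/matrixP => i j; rewrite !mxE mulrnAr.
rewrite (@expm_conj_diag _ _ _ _ (\row_i cis (- (t * e i)))) //; last first.
  move=> i; rewrite !mxE de.
  have -> : - ('i * t%:C) * (e i)%:C = 'i * (- (t * e i))%:C.
    by rewrite rmorphN rmorphM /=; ring.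
  exact: cvg_cis.
rewrite mxtrace_mulC mulmxA mulmxV // mul1mx mxtrace_diag.
(* Summing over the list of values, rather than over indices, lets the permutation [dE] apply. *)
transitivity (\sum_(z <- [seq d 0 i | i <- index_enum 'I_m])
  cis (- (t * complex.Re z))).
  by rewrite big_map; apply: eq_bigr => i _; rewrite mxE.
by rewrite (perm_big _ dE) big_map.
Qed.

(** * Factorization and binomial expansion *)

Lemma cmod_expr {R : realType} (z : R[i]) M : (cmod z ^+ (2 * M))%:C = (z * z^*%C) ^+ M.
Proof.
have E : (cmod z)%:C = `|z| by rewrite /cmod normc_def.
by rewrite exprM !rmorphXn /= E normCK.
Qed.

(** The modes are independent: expanding the product picks an occupation, 0 or 1, in each factor. *)
Lemma sum_energy_cis {R : realType} (L : nat) (E0 : R) (Lam : 'I_L -> R) t :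
  \sum_(n : {ffun 'I_L -> bool}) cis (- (t * energy E0 Lam n)) =
  cis (- (t * E0)) * \prod_k (1 + cis (- (t * Lam k))).
Proof.
pose F (k : 'I_L) (b : bool) := cis (- (t * (b%:R * Lam k))).
transitivity (cis (- (t * E0)) * \prod_k \sum_b F k b); last first.
  congr (_ * _); apply: eq_bigr => k _.
  by rewrite big_bool /F /= mul1r mul0r mulr0 oppr0 cis0 addrC.
rewrite bigA_distr_bigA mulr_sumr; apply: eq_bigr => n _.
by rewrite /energy mulrDr opprD cisD mulr_sumr -sumrN cis_sum.
Qed.

Lemma prod_distinct_vals {R : realType} (L : nat) (Lam : 'I_L -> R)
  (T : comNzRingType) (G : R -> T) :
  \prod_k G (Lam k) = \prod_(e <- distinct_vals Lam) G e ^+ mult Lam e.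
Proof.
rewrite /distinct_vals.
transitivity (\prod_(e <- [seq Lam k | k <- enum 'I_L]) G e).
  by rewrite big_map big_enum.
rewrite -prodr_undup_exp_count; apply: eq_bigr => e _; congr (_ ^+ _).
rewrite count_map -size_filter /mult cardE; congr size.
(* The set counted by [mult] is a classical one, so [asboolb] converts its membership back to the
   boolean test. *)
rewrite enumT; apply: eq_filter => k; rewrite /=; exact: esym (asboolb _).
Qed.

(** The bound [B] pads binomial expansions of different orders to a common index
    range, so that a product of them distributes over plain functions. *)
Lemma cis_binomial {R : realType} (x : R) N B : (2 * N <= B)%N ->
  ((1 + cis (- x)) * (1 + cis x)) ^+ N =
  \sum_(k < B.+1) 'C(2 * N, k)%:R * cis ((k%:R - N%:R) * x).
Proof.
move=> NB.
have cN : cis (- x) * cis x = 1 by rewrite -cisD addNr cis0.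
have -> : (1 + cis (- x)) * (1 + cis x) = cis (- x) * (1 + cis x) ^+ 2.
  have -> : 1 + cis (- x) = cis (- x) * (1 + cis x) by rewrite mulrDr mulr1 cN addrC.
  by rewrite -mulrA -expr2.
rewrite exprMn -exprM exprDn mulr_sumr.
rewrite (big_ord_widen_cond B.+1 xpredT (fun i =>
  cis (- x) ^+ N * (1 ^+ (2 * N - i) * cis x ^+ i *+ 'C(2 * N, i)))) ?ltnS //.
rewrite big_mkcond; apply: eq_bigr => k _ /=.
(* The padding indices beyond [2 * N] have a zero binomial coefficient. *)
case: ltnP => kN; last by rewrite bin_small // mul0r.
rewrite expr1n mul1r -mulr_natl mulrCA; congr (_ * _).
by rewrite -!cisMn -cisD; congr cis; rewrite mulrBl !mulr_natl mulNrn addrC.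
Qed.

(** A function [f] selects one binomial term for each entry of [s]; the selected phases add up to a
    single frequency. *)
Lemma prod_cis_expansion {R : realType} (s : seq R) (N : R -> nat) B t
   (hB : forall e, (2 * N e <= B)%N) :
  \prod_(e <- s) ((1 + cis (- (t * e))) * (1 + cis (t * e))) ^+ N e =
  \sum_(f : {ffun 'I_(size s) -> 'I_B.+1})
    (\prod_(j < size s) 'C(2 * N s`_j, f j)%:R) *
    cis (t * \sum_(j < size s) ((f j)%:R - (N s`_j)%:R) * s`_j).
Proof.
rewrite (big_nth 0) big_mkord.
under eq_bigr do rewrite (cis_binomial _ _ _ (hB _)).
rewrite bigA_distr_bigA; apply: eq_bigr => f _.
rewrite big_split /= mulr_sumr cis_sum; congr (_ * _).
by apply: eq_bigr => j _; congr cis; rewrite mulrCA.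
Qed.

(** With [b] the middle indices, this says that only the all-middle choice has frequency zero. *)
Lemma Q_indep_nat_shift {R : realType} (s : seq R) (a b : 'I_(size s) -> nat) :
  Q_lin_indep s ->
  \sum_(j < size s) ((a j)%:R - (b j)%:R) * s`_j = 0 -> a =1 b.
Proof.
move=> Hind h0 j.
have := Hind (fun j => (a j)%:R - (b j)%:R) _ j.
move=> /(_ _)/eqP; rewrite subr_eq0 eqr_nat => hab; apply/eqP/hab.
by rewrite -[RHS]h0; apply: eq_bigr => k _; rewrite rmorphB /= !ratr_nat.
Qed.

Lemma conjc_cis_prod {R : realType} (I : finType) (a : R) (x : I -> R) :
  (cis (- a) * \prod_k (1 + cis (- x k)))^*%C = cis a * \prod_k (1 + cis (x k)).
Proof.
transitivity ((cis (- a))^*%C * (\prod_k (1 + cis (- x k)))^*%C); first exact: rmorphM.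
rewrite conj_cis opprK; congr (_ * _).
transitivity (\prod_k (1 + cis (- x k))^*%C); first exact: rmorph_prod.
apply: eq_bigr => k _; transitivity (1^*%C + (cis (- x k))^*%C); first exact: rmorphD.
by rewrite conj_cis opprK conjc1.
Qed.

Theorem theorem6 (R : realType) (L : nat) (H : 'M[R[i]]_(2 ^ L))
  (E0 : R) (Lam : 'I_L -> R) :
  self_adjoint H ->
  char_poly H = \prod_(n : {ffun 'I_L -> bool}) ('X - ((energy E0 Lam n)%:C)%:P) ->
  Q_lin_indep (distinct_vals Lam) ->
  forall M : nat,
    time_average_is (fun t : R => cmod (chi H t) ^+ (2 * M))
      (\prod_(e <- distinct_vals Lam)
          ('C(2 * mult Lam e * M, mult Lam e * M))%:R).
Proof.
move=> Hsa Hchar Hind M.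
pose N e := (mult Lam e * M)%N.
(* No multiplicity exceeds [L], which gives a padding bound common to all values. *)
have hB e : (2 * N e <= 2 * (L * M))%N.
  by rewrite leq_mul2l leq_mul2r -[L in (_ <= L)%N]card_ord max_card !orbT.
set s := distinct_vals Lam in Hind *; set B := (2 * (L * M))%N in hB.
pose I := {ffun 'I_(size s) -> 'I_B.+1}.
pose c (f : I) : R := \prod_(j < size s) 'C(2 * N s`_j, f j)%:R.
pose w (f : I) : R := \sum_(j < size s) ((f j)%:R - (N s`_j)%:R) * s`_j.
have -> : (fun t : R => cmod (chi H t) ^+ (2 * M)) =
    (fun t => \sum_f c f * cos (t * w f)).
  apply/funext => t.
  (* The coefficients are real, so taking real parts turns each phase into its cosine. *)
  suff : (cmod (chi H t) ^+ (2 * M))%:C = \sum_f (c f)%:C * cis (t * w f).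
    move=> /(congr1 (@complex.Re R)) /= ->; rewrite raddf_sum /=.
    by apply: eq_bigr => f _; rewrite mul0r subr0.
  rewrite cmod_expr (chi_sum_cis _ _ _ _ _ Hsa Hchar) sum_energy_cis.
  (* The global phases of [E0] cancel and each factor meets its conjugate. *)
  rewrite conjc_cis_prod mulrACA -cisD addNr cis0 mul1r -big_split /= -prodrXl.
  rewrite (prod_distinct_vals L Lam _
    (fun e => ((1 + cis (- (t * e))) * (1 + cis (t * e))) ^+ M)).
  under eq_bigr do rewrite -exprM mulnC.
  rewrite (prod_cis_expansion s N B t hB); apply: eq_bigr => f _.
  by rewrite /c rmorph_prod; congr (_ * _); apply: eq_bigr => j _; rewrite rmorph_nat.
have hN j : (N (s`_j)%R < B.+1)%N by rewrite ltnS (leq_trans _ (hB s`_j)) // leq_pmull.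
(* The all-middle choice, the sole index of zero frequency; its coefficient is the claimed
   product. *)
pose f0 : I := [ffun j : 'I_(size s) => Ordinal (hN j)].
have -> : \prod_(e <- s) ('C(2 * mult Lam e * M, mult Lam e * M))%:R =
    \sum_(f | w f == 0) c f.
  rewrite (big_pred1 f0) => [|f].
    rewrite (big_nth 0) big_mkord; apply: eq_bigr => j _.
    by rewrite ffunE -mulnA.
  apply/eqP/eqP => [/(Q_indep_nat_shift s _ _ Hind) fN|->].
    by apply/ffunP => j; apply/val_inj; rewrite ffunE /= fN.
  by rewrite /w big1 // => j _; rewrite ffunE subrr mul0r.
exact: time_average_trig_sum.
Qed.
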